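(* Let $G$ be a connected planar bipartite graph, let $L_G$ be its associated positive special alternating link, and let $D=\overrightarrow{\mathcal{G}(L_G)}$ be its flattened diagram with the orientation and edge labeling of Crowell's model. Let $\{R_1,\dots,R_l\}$ and $\{R_{l+1},\dots,R_k\}$ be the clockwise oriented regions of $D$ whose boundary edges are labeled with $-t$'s and with $1$'s respectively. Then $$\Delta_{L_G}(-t)=M_{D}(t,\dots,t,1,\dots,1),$$ where $x_1=\cdots=x_l=t$ and $x_{l+1}=\cdots=x_k=1$ are set in the $M$-polynomial $M_D(x_1,\dots,x_k)$. Similarly, $$\mathrm{Homog}_q(\Delta_{L_G}(-t))=M_{D}(t,\dots,t,q,\dots,q),$$ where $\mathrm{Homog}_q(\Delta_{L_G}(-t))$ is the $q$-homogenization of $\Delta_{L_G}(-t)$ and $x_1=\cdots=x_l=t$, $x_{l+1}=\cdots=x_k=q$ are set in $M_D$.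
   Context: The link $L_G$. Fix a planar drawing of $G$. The medial graph $M(G)$ has as vertices the edges of $G$ (drawn at their midpoints), two of them joined by an edge whenever the corresponding edges of $G$ are consecutive in the boundary of a face of $G$. View the 4-regular plane graph $M(G)$ as a flattened link diagram; there are two ways to choose over/undercrossings making it alternating. Select the over/undercrossings and orient the strands so that every crossing is positive; the resulting oriented alternating link (with this diagram) is $L_G$. Crowell's model. Given an alternating diagram of an oriented link $L$, let $\mathcal{G}(L)$ be the plane 4-regular graph whose vertices are the crossings and whose edges are the arcs between crossings. Direct and weight its edges as follows (this direction is not the one coming from the link orientation). At each crossing, the two edges on the under-strand are directed into the crossing and the two edges on the over-strand are directed out of it; facing along the link orientation of the over-strand, the under-strand edge on the left gets weight $1$ and the under-strand edge on the right gets weight $-t$. (As the diagram is alternating, every edge is an under-strand edge at exactly one of its ends, so this is well defined.) The resulting weighted digraph is $\overrightarrow{\mathcal{G}(L)}$; write $w(e)\in\{1,-t\}$ for the weight of $e$. An arborescence rooted at $r$ is a spanning tree in which there is a unique directed path from $r$ to every vertex. The Alexander polynomial, a priori defined up to multiplication by $\pm t^m$, is normalized as in Crowell's theorem: $\Delta_L(t)=\sum_{A}\prod_{e\in E(A)}w(e)$, the sum over all arborescences $A$ of $\overrightarrow{\mathcal{G}(L)}$ rooted at a fixed vertex $r$; for special alternating $L$, $\Delta_L(t)$ so normalized satisfies, up to an overall sign, $\Delta_L(-t)\in\mathbb{Z}_{\ge0}[t]$. Regions and $M$-polynomial. $D=\overrightarrow{\mathcal{G}(L_G)}$ is an alternating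 dimap, i.e. a plane Eulerian digraph whose edges around each vertex are directed alternately in and out. A region (face) is clockwise oriented if it lies to the right of each of its boundary edges (the exterior region may be clockwise oriented). Every edge lies on the boundary of exactly one clockwise oriented region, and for $D=\overrightarrow{\mathcal{G}(L_G)}$ each clockwise oriented region has boundary edges all labeled $1$ or all labeled $-t$. With $R_1,\dots,R_k$ the clockwise oriented regions, set $var(e)=x_i$ if $e$ is in the boundary of $R_i$, and $M_{D}(x_1,\dots,x_k)=M_{D,r}(x_1,\dots,x_k)=\sum_A\prod_{e\in E(A)}var(e)$, the sum over arborescences $A$ of $D$ rooted at a vertex $r$; this polynomial does not depend on $r$. Homogenization. For $P(t)=\sum_i c_it^i$, $\mathrm{Homog}_q(P)=\sum_i c_i t^iq^{d-i}$ with $d=|V(D)|-1$, the degree of the homogeneous polynomial $M_D$. *)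

(* Defs.v *)
From mathcomp Require Import all_boot all_order all_algebra all_fingroup.
From mathcomp Require Import mpoly.
Set Implicit Arguments.
Unset Strict Implicit.
Unset Printing Implicit Defensive.
Import Order.TTheory GRing.Theory Num.Theory.
Local Open Scope ring_scope.

(* A finite multigraph (parallel edges and loops allowed).  The pairs
   (e, false) and (e, true) are the two darts (half-edges) of e; [tail x] is
   the vertex that the dart x leaves. *)
Record graph := Graph {
  vertex : finType;
  edge : finType;
  tail : edge * bool -> vertex }.

Definition dart (G : graph) : finType := (edge G * bool)%type.

Definition flip (E : finType) (x : E * bool) : E * bool := (x.1, ~~ x.2).

Definition connected (G : graph) : Prop :=
  (0 < #|vertex G|)%N /\
  forall u v : vertex G,
    connect [rel a b | [exists x : dart G, (tail x == a) && (tail (flip x) == b)]]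
      u v.

Definition bipartite (G : graph) : Prop :=
  exists c : vertex G -> bool, forall x : dart G, c (tail (flip x)) != c (tail x).

(* A drawing on an oriented surface, as a rotation system: [rot x] is the next
   dart counterclockwise after x around the vertex [tail x]. *)
Record embedded_graph := EmbeddedGraph {
  carrier :> graph;
  rot : {perm dart carrier};
  rotP : forall x y : dart carrier, (y \in porbit rot x) = (tail x == tail y) }.

(* The dart following x on the boundary of the region to the right of x. *)
Definition right_next (G : embedded_graph) (x : dart G) : dart G := rot G (flip x).

Lemma flipK (E : finType) : involutive (@flip E).
Proof. by case=> e b; rewrite /flip /= negbK. Qed.

Lemma right_next_inj (G : embedded_graph) : injective (@right_next G).
Proof. by move=> x y /perm_inj /(can_inj (@flipK _)). Qed.

(* A region is represented by the set of the darts that it lies to the right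
   of; every dart belongs to exactly one region. *)
Definition regions (G : embedded_graph) : {set {set dart G}} :=
  porbits (perm (@right_next_inj G)).

Definition boundary (G : embedded_graph) (R : {set dart G}) : {set edge G} :=
  [set e | [exists b : bool, (e, b) \in R]].

(* Euler's formula: for a connected graph, the drawing is on the sphere.  The
   maximum is there for the one-vertex graph without edges, whose unique region
   has no dart. *)
Definition plane (G : embedded_graph) : Prop :=
  (#|vertex G| + maxn 1 #|regions G| = #|edge G| + 2)%N.

(* A dart x of G stands for the corner between x and [rot x], at which the edges
   of x and [rot x] are consecutive in the boundary of a region.  It gives one
   edge of the medial graph, whose dart (x, false) starts at the midpoint of the
   edge of x, and whose dart (x, true) starts at that of [rot x]. *)
Definition medial_graph (G : embedded_graph) : graph :=
  @Graph (edge G) (dart G) (fun h => if h.2 then (rot G h.1).1 else h.1.1).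

(* Around the midpoint of a dart x drawn from west to east, the four medial
   darts are, counterclockwise:
     north-west  (x, false)              south-west  (rot^-1 x, true)
     south-east  (flip x, false)         north-east  (rot^-1 (flip x), true). *)
Definition medial_rot_fun (G : embedded_graph) (h : dart (medial_graph G)) :
    dart (medial_graph G) :=
  if h.2 then (flip (rot G h.1), false) else ((rot G)^-1%g h.1, true).

Lemma medial_rot_inj (G : embedded_graph) : injective (@medial_rot_fun G).
Proof.
case=> [x []] [y []] //=; rewrite /medial_rot_fun /= => h; have := congr1 fst h => /=.
- by move=> /(can_inj (@flipK (edge G))) /perm_inj ->.
- by move=> /perm_inj ->.
Qed.

Lemma medial_rotP (G : embedded_graph) (g h : dart (medial_graph G)) :
  (h \in porbit (perm (@medial_rot_inj G)) g) = (tail g == tail h).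
Proof.
set s := perm _.
have sT x : s (x, true) = (flip (rot G x), false) by rewrite permE.
have sF x : s (x, false) = ((rot G)^-1%g x, true) by rewrite permE.
have sP z : porbit s (s z) = porbit s z by have := porbit_perm s 1 z; rewrite expg1.
have flipP x : porbit s (x, false) = porbit s (flip x, false).
  by rewrite -sP sF -sP sT permKV.
have base z : porbit s z = porbit s ((tail z, false), false).
  have all e b : porbit s ((e, b), false) = porbit s ((e, false), false).
    by case: b; first exact: flipP (e, true).
  case: z => x [] /=; last by case: x => e b; apply: all.
  by rewrite -sP sT -flipP; case: (rot G x) => e b; apply: all.
apply/idP/eqP => [/porbitP[i ->]|gh]; last first.
  by rewrite -eq_porbit_mem base (base g) gh.
elim: i => [|i IH]; first by rewrite expg0 perm1.
rewrite expgSr permM IH; case: (_ g) => x [].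
- by rewrite sT.
- by rewrite sF /= permKV.
Qed.

Definition medial (G : embedded_graph) : embedded_graph :=
  EmbeddedGraph (@medial_rotP G).

(* H is the 4-regular embedded graph obtained by flattening the crossings.  A
   dart of H leaves a crossing; [over x] says that it belongs to the over-strand
   of that crossing, and [out x] that the orientation of the link runs along x
   away from the crossing.  The strands go straight through a crossing, that is,
   from x to [rot H (rot H x)]. *)
Record alternating_diagram (H : embedded_graph) := AlternatingDiagram {
  over : dart H -> bool;
  out : dart H -> bool;
  four_regular : forall v : vertex H, #|[set x : dart H | tail x == v]| = 4;
  over_rot : forall x, over (rot H x) = ~~ over x;
  out_straight : forall x, out (rot H (rot H x)) = ~~ out x;
  out_flip : forall x, out (flip x) = ~~ out x;
  over_flip : forall x, over (flip x) = ~~ over x }.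

(* The direction of the under-strand is a counterclockwise quarter-turn away from
   the direction of the over-strand. *)
Definition positive (H : embedded_graph) (L : alternating_diagram H) : Prop :=
  forall x : dart H, over L x -> out L x -> out L (rot H x).

(* The [positive] diagrams on [medial G] are the diagrams of the link L_G.  They
   exist: orient the medial edges counterclockwise around the vertices of one
   colour and clockwise around the others. *)
Lemma positive_medial_exists (G : embedded_graph) :
  bipartite G -> exists L : alternating_diagram (medial G), positive L.
Proof.
case=> c cP.
have rT x : rot (medial G) (x, true) = (flip (rot G x), false) by rewrite permE.
have rF x : rot (medial G) (x, false) = ((rot G)^-1%g x, true) by rewrite permE.
have cN x : c (tail (flip x)) = ~~ c (tail x).
  by move: (cP x); case: (c _); case: (c _).
have tail_rot x : tail (rot G x) = tail x.
  apply/esym/eqP; rewrite -rotP; have := mem_porbit (rot G) 1 x.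
  by rewrite expg1.
have tail_rotV x : tail ((rot G)^-1%g x) = tail x by rewrite -tail_rot permKV.
pose ov (h : dart (medial G)) := h.2.
pose ou (h : dart (medial G)) := c (tail h.1) (+) h.2.
have freg (v : vertex (medial G)) :
    #|[set x : dart (medial G) | tail x == v]| = 4.
  have -> : [set x : dart (medial G) | tail x == v] =
      [set (v, b.1, false) | b : bool * unit] :|:
      [set ((rot G)^-1%g (v, b.1), true) | b : bool * unit].
    apply/setP => -[x b]; rewrite !inE; apply/eqP/orP => /=.
    - case: b => /= E; [right | left]; apply/imsetP.
      + by exists ((rot G x).2, tt) => //=; rewrite -E -surjective_pairing permK.
      + by exists (x.2, tt) => //=; rewrite -E -surjective_pairing.
    - by case=> /imsetP[[d _] _ [-> ->]] //=; rewrite permKV.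
  rewrite cardsU !card_imset ?cardsT; last 2 first.
  - by case=> [a []] [b []] /= [/perm_inj[->]].
  - by case=> [a []] [b []] /= [->].
  rewrite card_prod card_bool card_unit (_ : _ :&: _ = set0) ?cards0 //.
  by apply/setP => x; rewrite !inE; apply/andP => -[/imsetP[a _ ->] /imsetP[]].
have ovr x : ov (rot (medial G) x) = ~~ ov x.
  by case: x => x []; rewrite ?rT ?rF.
have ous x : ou (rot (medial G) (rot (medial G) x)) = ~~ ou x.
  case: x => x []; rewrite ?(rT, rF) /ou /= ?(rT, rF, tail_rotV, permKV) /=.
  - by rewrite cN tail_rot addbT addbT.
  - by rewrite cN !addbF.
have ouf x : ou (flip x) = ~~ ou x by case: x => x b; rewrite /ou /= addbN.
exists (AlternatingDiagram freg ovr ous ouf (fun _ => erefl)) => -[x []] //= _.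
by rewrite rT /ou /= cN tail_rot addbT addbF.
Qed.

Record digraph := Digraph {
  dvertex : finType;
  dedge : finType;
  source : dedge -> dvertex;
  target : dedge -> dvertex }.

Definition joined (D : digraph) (A : {set dedge D}) : rel (dvertex D) :=
  [rel u v | [exists e in A, ((source e == u) && (target e == v))
                          || ((source e == v) && (target e == u))]].

(* Directions are disregarded here.  There is no cycle when the two ends of any
   edge e are disconnected by the removal of e. *)
Definition spanning_tree (D : digraph) (A : {set dedge D}) : bool :=
  [forall u, forall v, connect (joined A) u v]
  && [forall e in A, ~~ connect (joined (A :\ e)) (source e) (target e)].

Fixpoint directed_walk (D : digraph) (u v : dvertex D) (p : seq (dedge D)) : bool :=
  if p is e :: p' then (source e == u) && directed_walk (target e) v p'
  else u == v.

Definition directed_path (D : digraph) (A : {set dedge D}) (u v : dvertex D)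
    (p : seq (dedge D)) : bool :=
  [&& all (mem A) p, directed_walk u v p & uniq (u :: [seq target e | e <- p])].

(* Counting the paths among the sequences of at most #|dvertex D| edges misses
   none, since a path does not repeat vertices. *)
Definition arborescence (D : digraph) (r : dvertex D) (A : {set dedge D}) : bool :=
  spanning_tree A &&
  [forall v, #|[set p : #|dvertex D|.-bseq (dedge D) | directed_path A r v p]| == 1%N].

Definition arborescence_sum (D : digraph) (S : comNzRingType) (w : dedge D -> S)
    (r : dvertex D) : S :=
  \sum_(A : {set dedge D} | arborescence r A) \prod_(e in A) w e.

Section Crowell.
Variables (H : embedded_graph) (L : alternating_diagram H).

Definition over_end (e : edge H) : dart H :=
  if over L (e, false) then (e, false) else (e, true).
Definition under_end (e : edge H) : dart H := flip (over_end e).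

Definition crowell_digraph : digraph :=
  @Digraph (vertex H) (edge H) (fun e => tail (over_end e))
    (fun e => tail (under_end e)).

(* An under-strand dart is on the left of the over-strand when the preceding
   dart counterclockwise, which is on the over-strand, points along its
   orientation. *)
Definition crowell_weight (e : dedge crowell_digraph) : {poly int} :=
  if out L ((rot H)^-1%g (under_end e)) then 1 else - 'X.

(* The Alexander polynomial is defined up to multiplication by a unit +-t^m; by
   Crowell's theorem this sum is one of its representatives, and it is the one
   chosen here. *)
Definition alexander (r : dvertex crowell_digraph) : {poly int} :=
  arborescence_sum crowell_weight r.

(* An edge is directed along the dart [over_end e]. *)
Definition clockwise_regions : {set {set dart H}} :=
  [set R in regions H | [forall e in boundary R, over_end e \in R]].

Definition labeled_regions (a : {poly int}) : {set {set dart H}} :=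
  [set R in clockwise_regions | [forall e in boundary R, crowell_weight e == a]].

Definition region_var k (R : 'I_k -> {set dart H}) (e : dedge crowell_digraph) :
    {mpoly int[k]} :=
  if [pick i | e \in boundary (R i)] is Some i then 'X_i else 0.

Definition M_polynomial k (R : 'I_k -> {set dart H}) (r : dvertex crowell_digraph) :
    {mpoly int[k]} :=
  arborescence_sum (region_var R) r.

End Crowell.

Definition var_t : {mpoly int[2]} := 'X_(ord0 : 'I_2).
Definition var_q : {mpoly int[2]} := 'X_(ord_max : 'I_2).

Definition homogenize (d : nat) (P : {poly int}) : {mpoly int[2]} :=
  \sum_(i < size P) P`_i *: (var_t ^+ i * var_q ^+ (d - i)).

(* Main.v *)
(* In a positive diagram the weight of an edge of Crowell's digraph is constant
   along each clockwise oriented region, so substituting -t in the Alexander sum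
   and specialising the region variables give the same weights.  Only the roots r
   and s differ.  Following each edge by the next one of its clockwise region
   balances the weights at every vertex; adding to an arborescence rooted at r an
   edge into r, and then removing the edge out of r on the cycle so obtained,
   shows that the arborescence sum is then a harmonic function of the root.  At
   positive integers t the weights are positive, so it is constant by the maximum
   principle, hence constant as a polynomial.  The homogenization follows as all
   arborescences have |V| - 1 edges. *)

From HB Require Import structures.
Require Import Defs.
From mathcomp Require Import all_boot all_order all_algebra all_fingroup.
From mathcomp Require Import mpoly.
Set Implicit Arguments.
Unset Strict Implicit.
Unset Printing Implicit Defensive.
Import Order.TTheory GRing.Theory Num.Theory.
Local Open Scope ring_scope.

(** * Reachability, by induction on the last step of a walk *)

Lemma connect_ind_r (T : finType) (a : rel T) (x : T) (P : T -> Prop) :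
  P x -> (forall y z, connect a x y -> P y -> a y z -> P z) ->
  forall y, connect a x y -> P y.
Proof.
move=> Px IH y /connectP[p]; elim/last_ind: p y => [|p z IHp] y /=; first by move=> _ ->.
rewrite rcons_path last_rcons => /andP[pth az] ->.
by apply: IH az; [apply/connectP; exists p | apply: IHp pth _].
Qed.

Lemma connect_last (T : finType) (a : rel T) (x y : T) : connect a x y ->
  x = y \/ exists2 z, connect a x z & a z y.
Proof.
by move: y; apply: connect_ind_r => [|z t xz _ zt]; [left | right; exists z].
Qed.

(** * Arborescences in terms of in-degrees and reachability from the root *)

Section Arborescences.
Variable D : digraph.
Implicit Types (A : {set dedge D}) (e g : dedge D) (u v r : dvertex D).

Definition arc A : rel (dvertex D) :=
  [rel u v | [exists e in A, (source e == u) && (target e == v)]].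

Lemma arcP A u v :
  reflect (exists e, [/\ e \in A, source e = u & target e = v]) (arc A u v).
Proof.
apply: (iffP existsP) => [[e /and3P[eA /eqP<- /eqP<-]]|[e [eA <- <-]]]; exists e => //.
by rewrite eA !eqxx.
Qed.

Lemma mem_arc A e : e \in A -> arc A (source e) (target e).
Proof. by move=> eA; apply/arcP; exists e. Qed.

Lemma arc_sub A (B : {set dedge D}) :
  A \subset B -> subrel (connect (arc A)) (connect (arc B)).
Proof.
move=> sAB; apply: connect_sub => u v /arcP[e [eA <- <-]].
by apply/connect1/mem_arc/(subsetP sAB).
Qed.

Lemma connect_arc_joined A u v : connect (arc A) u v -> connect (joined A) u v.
Proof.
apply: connect_sub => {}u {}v /arcP[e [eA su tv]]; apply: connect1.
by apply/existsP; exists e; rewrite eA su tv !eqxx.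
Qed.

Lemma joined_sym A : ssrbool.symmetric (joined A).
Proof. by move=> u v; apply: eq_existsb => e; rewrite /= orbC. Qed.

(** A local form of arborescences, proved equivalent in [arborescenceP]; it allows the edges to be
    chosen vertex by vertex. *)
Definition branching r A :=
  [forall u, #|[set e in A | target e == u]| == (u != r)] &&
  [forall u, connect (arc A) r u].

Lemma directed_walk_rcons u v p e :
  directed_walk u v (rcons p e) = directed_walk u (source e) p && (target e == v).
Proof. by elim: p u => [|g p IH] u /=; rewrite ?andbT 1?eq_sym // IH andbA. Qed.

Lemma directed_walk_connect A u v p :
  all (mem A) p -> directed_walk u v p -> connect (arc A) u v.
Proof.
elim: p u => [|e p IH] u /=; first by move=> _ /eqP->; apply: connect0.
case/andP=> eA pA /andP[/eqP<- w]; apply: connect_trans (IH _ pA w).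
exact/connect1/mem_arc.
Qed.

(** Shortening a walk to one without repeated vertices yields both the [uniq] condition and the
    length bound. *)
Lemma connect_directed_path A u v : connect (arc A) u v ->
  exists p : #|dvertex D|.-bseq (dedge D), directed_path A u v p.
Proof.
move=> /connectP[q0 pq0 ->]; case/shortenP: pq0 => q pq uq _.
have [p [pA pw pq']] : exists p, [/\ all (mem A) p, directed_walk u (last u q) p
    & [seq target e | e <- p] = q].
  elim: q u pq {uq} => [|x q IH] u /=; first by exists [::]; rewrite /= eqxx.
  case/andP=> /arcP[e [eA su tx]] /IH[p [pA pw pq]]; exists (e :: p).
  by rewrite /= su tx eqxx eA pA pq.
have sp : (size p <= #|dvertex D|)%N.
  rewrite -(size_map (@target D)) pq'; apply: leq_trans (max_card (mem (u :: q))).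
  by rewrite (card_uniqP uq) /=.
by exists (Bseq sp); rewrite /directed_path pA pw pq' uq.
Qed.

Lemma branching_in r A e g : branching r A ->
  e \in A -> g \in A -> target e = target g -> e = g.
Proof.
case/andP=> /forallP/(_ (target g))/eqP c _ eA gA tt.
have /card_le1_eqP : (#|[set e in A | target e == target g]| <= 1)%N by rewrite c leq_b1.
by apply; rewrite inE ?eA ?gA ?tt eqxx.
Qed.

Lemma branching_root r A e : branching r A -> e \in A -> target e != r.
Proof.
case/andP=> /forallP/(_ (target e))/eqP c _ eA; apply/eqP => te.
have := card0_eq (etrans c _); rewrite te eqxx => /(_ erefl e).
by rewrite !inE eA te eqxx.
Qed.

(** If the ends of [e] stayed joined without [e], the set of vertices reachable from [target e]
    would be closed under going back along edges of [A]; it would then contain [r], which no edge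
    enters. *)
Lemma branching_spanning_tree r A : branching r A -> spanning_tree A.
Proof.
move=> br; have [_ /forallP rA] := andP br; apply/andP; split.
  apply/forallP => u; apply/forallP => v.
  apply: connect_trans (connect_arc_joined (rA v)).
  rewrite (sym_connect_sym (@joined_sym A)); exact: connect_arc_joined.
apply/forall_inP => e eA; apply/negP => con.
pose S := connect (arc A) (target e).
have back g : g \in A -> g != e -> S (target g) -> S (source g).
  move=> gA /eqP ge /connect_last[|[z Sz /arcP[h [hA hz]]]].
    by move/(branching_in br eA gA)/esym/ge.
  by move/(branching_in br hA gA)=> <-; rewrite hz.
have Se : S (source e).
  rewrite (sym_connect_sym (@joined_sym _)) in con.
  move: (source e) con; apply: connect_ind_r => [|u v _ Su]; first exact: connect0.
  case/existsP=> g /andP[/setD1P[ge gA]] /orP[]/andP[/eqP gu /eqP gv]; subst u v.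
    exact: connect_trans Su (connect1 (mem_arc gA)).
  exact: back.
have Sr : S r.
  have imp y : connect (arc A) r y -> S y -> S r.
    move: y; apply: connect_ind_r => [|y z _ IH /arcP[g [gA gy gz]] Sz] //.
    by apply: IH; rewrite -gy; have [-> //|ge] := eqVneq g e; apply: back; rewrite ?gz.
  exact: imp (rA (target e)) (connect0 _ _).
case/connect_last: Sr => [tr|[z _ /arcP[g [gA _ tr]]]].
  by have := branching_root br eA; rewrite tr eqxx.
by have := branching_root br gA; rewrite tr eqxx.
Qed.

(** Read from the end: the last edge is determined by its target, and no edge enters [r]. *)
Lemma branching_path_uniq r A v p q : branching r A ->
  all (mem A) p -> directed_walk r v p -> all (mem A) q -> directed_walk r v q -> p = q.
Proof.
move=> br; elim/last_ind: p v q => [|p e IH] v q; case/lastP: q => [|q g] //;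
  rewrite ?all_rcons ?directed_walk_rcons.
- move=> _ /eqP<- /andP[gA _] /andP[_ /eqP tg].
  by have := branching_root br gA; rewrite tg eqxx.
- move=> /andP[eA _] /andP[_ /eqP te] _ /eqP rv.
  by have := branching_root br eA; rewrite te rv eqxx.
move=> /andP[eA pA] /andP[wp /eqP te] /andP[gA qA] /andP[wq /eqP tg].
have eg : e = g by apply: branching_in br eA gA _; rewrite te.
by subst g; rewrite (IH _ _ pA wp qA wq).
Qed.

(** After its last use of [e], a walk continues from [target e]. *)
Lemma connect_arcD1 A e u v : connect (arc A) u v ->
  connect (arc (A :\ e)) u v \/ connect (arc (A :\ e)) (target e) v.
Proof.
move: v; apply: connect_ind_r => [|v x _ IH /arcP[g [gA gv gx]]]; first by left.
subst v x.
have [-> | ge] := eqVneq g e; first by right.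
have gA' : connect (arc (A :\ e)) (source g) (target g).
  by apply/connect1/mem_arc; rewrite !inE ge.
by case: IH => /connect_trans/(_ gA'); [left | right].
Qed.

Lemma arborescence_connect r A v : arborescence r A -> connect (arc A) r v.
Proof.
case/andP=> _ /forallP/(_ v)/cards1P[p /setP/(_ p)]; rewrite !inE eqxx.
by case/and3P=> pA pw _; apply: directed_walk_connect pA pw.
Qed.

Lemma arborescenceP r A : arborescence r A = branching r A.
Proof.
apply/idP/idP => [ar|br]; last first.
  rewrite /arborescence (branching_spanning_tree br) /=; apply/forallP => v.
  have [_ /forallP/(_ v)/connect_directed_path[p pP]] := andP br.
  apply/cards1P; exists p; apply/setP => q; rewrite !inE.
  apply/idP/eqP => [qP|-> //]; apply: val_inj.
  case/and3P: qP => qA qw _; case/and3P: pP => pA pw _.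
  exact: branching_path_uniq br qA qw pA pw.
have rA v := arborescence_connect v ar.
have [/andP[_ /forall_inP acyc] _] := andP ar.
have cyc e : e \in A -> connect (arc (A :\ e)) (target e) (source e) -> False.
  move=> eA /connect_arc_joined; rewrite (sym_connect_sym (@joined_sym _)).
  exact/negP/acyc.
(* Some walk from [r] to [source e] avoids [e], as otherwise [e] closes a directed cycle. A walk to
   [target e] avoiding [e] would then join both ends of [e] in [A :\ e]. *)
have rt e : e \in A -> ~ connect (arc (A :\ e)) r (target e).
  move=> eA /connect_arc_joined c; case: (connect_arcD1 e (rA (source e))) => [|/(cyc _ eA)[]].
  move/connect_arc_joined => c'; case/negP: (acyc e eA); apply: connect_trans c.
  by rewrite (sym_connect_sym (@joined_sym _)).
apply/andP; split; last by apply/forallP.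
apply/forallP => v; have [->|vr] := eqVneq v r.
  rewrite cards_eq0; apply/eqP/setP => e; rewrite !inE; apply/andP => -[eA /eqP te].
  by case: (rt e eA); rewrite te.
have [rv|[u _ /arcP[e [eA _ te]]]] := connect_last (rA v); first by rewrite rv eqxx in vr.
apply/cards1P; exists e; apply/setP => g; rewrite !inE.
apply/andP/eqP => [[gA /eqP tg]|-> //]; last by rewrite te.
apply/eqP/negP => /negP ge.
have gA' : connect (arc (A :\ e)) (source g) (target e).
  by rewrite te -tg; apply/connect1/mem_arc; rewrite !inE ge.
(* Reaching [source g] from [r] without [e] contradicts [rt]; reaching it from the common target of
   [e] and [g] closes a cycle through [g]. *)
case: (connect_arcD1 e (rA (source g))) => [/connect_trans/(_ gA')/rt|]; first exact.
move/(arc_sub (subD1set _ _))/(connect_arcD1 g); rewrite te -tg.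
by case => /cyc; apply.
Qed.

(** * Choices of one incoming edge per vertex, and the harmonic identity *)

Definition parent (p : {ffun dvertex D -> dedge D}) u := source (p u).

(* Such a p encodes an arborescence rooted at r together with one edge into r. *)
Definition rooted (p : {ffun dvertex D -> dedge D}) r :=
  [forall u, target (p u) == u] && [forall u, fconnect (parent p) u r].

(** Walks from [r] read backwards are iterates of [parent p] ending at [r]; the edge [p r] is the
    one left out of the branching. *)
Lemma rooted_branching (p : {ffun dvertex D -> dedge D}) r : (forall u, target (p u) = u) ->
  branching r (p @: [set~ r]) = rooted p r.
Proof.
move=> tp; have -> : rooted p r = [forall u, fconnect (parent p) u r].
  by rewrite /rooted (introT forallP) // => u; apply/eqP.
have -> : branching r (p @: [set~ r]) = [forall u, connect (arc (p @: [set~ r])) r u].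
  rewrite /branching (introT forallP) // => u; apply/eqP.
  have [->|ur] := eqVneq u r.
    apply/eqP; rewrite cards_eq0; apply/eqP/setP => e; rewrite !inE; apply/andP.
    by case=> /imsetP[v]; rewrite !inE => vr -> /eqP; rewrite tp => /eqP; apply/negP.
  apply/eqP/cards1P; exists (p u); apply/setP => e; rewrite !inE.
  apply/andP/eqP => [[/imsetP[v _ ->]]|->]; first by rewrite tp => /eqP->.
  by rewrite tp imset_f // !inE.
apply: eq_forallb => u; apply/idP/idP.
  move: u; apply: connect_ind_r => // u v _ IH /arcP[_ [/imsetP[x _ ->] pu pv]].
  have {}pv : x = v by rewrite -pv tp.
  by apply: connect_trans IH; rewrite -pu pv; apply: fconnect1.
move/iter_findex; move: (findex _ _ _) => n; elim: n u => [|n IH] u /=.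
  by move->; apply: connect0.
rewrite -iterS iterSr => /IH c; have [->|ur] := eqVneq u r; first exact: connect0.
apply: connect_trans c _; apply: connect1; apply/arcP; exists (p u).
by rewrite imset_f ?inE // tp.
Qed.

Lemma arborescence_sum_rooted (S : comNzRingType) (w : dedge D -> S) e :
  w e * arborescence_sum w (target e) =
  \sum_(p | rooted p (target e) && (p (target e) == e)) \prod_u w (p u).
Proof.
rewrite /arborescence_sum (eq_bigl _ _ (arborescenceP (target e))) mulr_sumr.
set r := target e; pose h (p : {ffun dvertex D -> dedge D}) := p @: [set~ r].
(* The first [e] is the edge added at the root; the default [e] is never reached when [A] is a
   branching. *)
pose h' (A : {set dedge D}) : {ffun dvertex D -> dedge D} :=
  [ffun u => if u == r then e else odflt e [pick g in A | target g == u]].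
have h'P A u : branching r A -> target (h' A u) = u /\ (u != r -> h' A u \in A).
  move=> br; rewrite ffunE; have [->//|ur] := eqVneq u r.
  case: pickP => [g /andP[gA /eqP] //|no] /=.
  case/andP: br => /forallP/(_ u)/eqP; rewrite ur => c _.
  have: [set g in A | target g == u] = set0.
    by apply/setP => g; rewrite !inE; apply: no.
  by move/(congr1 (fun B : {set _} => #|B|)); rewrite c cards0.
rewrite (reindex_onto h h') => [|A br].
  apply: eq_big => [p|p].
    apply/andP/andP => [[br /eqP hp]|[rp /eqP pe]].
      have tp u : target (p u) = u by rewrite -hp; case: (h'P _ u br).
      have pr : p r = e by rewrite -hp ffunE eqxx.
      by rewrite -rooted_branching // pr eqxx.
    have tp u : target (p u) = u by case/andP: rp => /forallP/(_ u)/eqP.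
    have br : branching r (h p) by rewrite rooted_branching.
    split=> //; apply/eqP/ffunP => u; have [tu] := h'P _ u br.
    have [->|ur] := eqVneq u r; first by rewrite ffunE eqxx pe.
    by case/(_ isT)/imsetP => v _ hv; rewrite hv; congr (p _); rewrite -tu hv tp.
  case/andP=> br /eqP hp.
  have tp u : target (p u) = u by rewrite -hp; case: (h'P _ u br).
  have pr : p r = e by rewrite -hp ffunE eqxx.
  rewrite [RHS](bigD1 r) //= pr; congr (_ * _).
  rewrite big_imset; last by move=> u v _ _ /(congr1 (@target D)); rewrite !tp.
  by apply: eq_bigl => u; rewrite !inE.
apply/setP => g; apply/imsetP/idP => [[u]|gA].
  by rewrite !inE => ur ->; have [_] := h'P _ u br; apply.
have tg := branching_root br gA; exists (target g); first by rewrite !inE.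
have [t /(_ tg) hA] := h'P _ (target g) br.
by apply: (branching_in br) => //; rewrite t.
Qed.

(** When [p] is rooted at [r], the vertex [r] lies on a cycle of [parent p]. Several chosen edges
    may leave [r], but only the one ending at the predecessor [finv f r] on this cycle has a target
    at which [p] is rooted. *)
Lemma card_rooted_source p r :
  #|[set e | [&& source e == r, rooted p (target e) & p (target e) == e]]| = rooted p r.
Proof.
pose f := parent p.
have fr e : source e = r -> p (target e) = e -> f (target e) = r.
  by move=> se pe; rewrite /f /parent pe.
have [rp|nrp] := boolP (rooted p r); last first.
  apply/eqP; rewrite cards_eq0; apply/eqP/setP => e; rewrite !inE; apply/negP.
  case/and3P=> /eqP se /andP[tp /forallP re] /eqP pe; case/negP: nrp.
  rewrite /rooted tp; apply/forallP => u; apply: connect_trans (re u) _.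
  by apply: connect1; rewrite /= -/f fr.
have [/forallP tp /forallP reach] := andP rp.
have cyc : fcycle f (fingraph.orbit f r) by rewrite -fconnect_f; apply: reach.
have fv : f (finv f r) = r.
  by rewrite -iterS prednK ?order_gt0 //; apply: (orbitPcycle 0 4).1 cyc.
have rv : rooted p (finv f r).
  apply/andP; split; first exact/forallP.
  by apply/forallP => u; apply: connect_trans (reach u) (fconnect_finv f r).
apply/eqP/cards1P; exists (p (finv f r)); apply/setP => e; rewrite !inE.
apply/and3P/eqP => [[/eqP se /andP[_ /forallP re] /eqP pe]|->]; last first.
  by rewrite (eqP (tp _)) eqxx rv -/(parent p _) -/f fv.
rewrite -pe; congr (p _); apply: ((orbitPcycle 0 5).1 cyc).
- by rewrite -fconnect_orbit.
- by rewrite -fconnect_orbit fconnect_finv.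
- by rewrite fv fr.
Qed.

Lemma card_rooted_target p r :
  #|[set e | [&& target e == r, rooted p (target e) & p (target e) == e]]| = rooted p r.
Proof.
have [rp|nrp] := boolP (rooted p r).
  have [/forallP tp _] := andP rp.
  apply/eqP/cards1P; exists (p r); apply/setP => e; rewrite !inE.
  apply/and3P/eqP => [[/eqP-> _ /eqP->] //|->].
  by rewrite (eqP (tp r)) rp !eqxx.
apply/eqP; rewrite cards_eq0; apply/eqP/setP => e; rewrite !inE; apply/negP.
by case/and3P=> /eqP-> rp; rewrite rp in nrp.
Qed.

(* Both sides enumerate the choices of one edge into each vertex for which r
   lies on a cycle reaching every vertex: the cycle is opened at its edge into r
   on the left, and at its edge out of r on the right. *)
Lemma arborescence_sum_harmonic (S : comNzRingType) (w : dedge D -> S) r :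
  \sum_(e | target e == r) w e * arborescence_sum w r =
  \sum_(e | source e == r) w e * arborescence_sum w (target e).
Proof.
pose W (p : {ffun dvertex D -> dedge D}) := \prod_u w (p u).
have count (P : pred (dedge D)) :
    \sum_(e | P e) w e * arborescence_sum w (target e) =
    \sum_p W p *+ #|[set e | [&& P e, rooted p (target e) & p (target e) == e]]|.
  under eq_bigr => e _ do rewrite arborescence_sum_rooted big_mkcond.
  rewrite exchange_big /=; apply: eq_bigr => p _.
  rewrite -sumr_const [RHS]big_mkcond [LHS]big_mkcond; apply: eq_bigr => e _.
  by rewrite !inE; case: (P e).
rewrite count (eq_bigr (fun e => w e * arborescence_sum w (target e))); last first.
  by move=> e /eqP->.
by rewrite count; apply: eq_bigr => p _; rewrite card_rooted_source card_rooted_target.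
Qed.

(** * Independence of the root for balanced positive weights *)

Section RootIndependence.
Variable next : dedge D -> dedge D.
Hypothesis next_inj : injective next.
Hypothesis source_next : forall e, source (next e) = target e.

Lemma sum_source_next (S : nmodType) (w : dedge D -> S) r :
  (forall e, w (next e) = w e) ->
  \sum_(e | source e == r) w e = \sum_(e | target e == r) w e.
Proof.
move=> wn; rewrite (reindex_inj next_inj) /=.
by apply: eq_big => e; rewrite ?source_next ?wn.
Qed.

(** Iterating the permutation [next] from [e] follows edges forward and comes back to the
    predecessor of [e], whose target is [source e]. *)
Lemma target_closed_source (P : pred (dvertex D)) :
  (forall e, P (source e) -> P (target e)) -> forall e, P (target e) -> P (source e).
Proof.
move=> cl e Pe; rewrite -(f_finv next_inj e); rewrite source_next.
have : fconnect next e (finv next e) by apply: fconnect_finv.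
move/iter_findex <-; elim: (findex _ _ _) => //= n.
by rewrite -source_next => /cl.
Qed.

(* Maximum principle: [next] balances the weight entering and leaving each
   vertex, which makes the sum a harmonic function of the root, so the roots
   where it is maximal are closed under out-neighbours. *)
Lemma arborescence_sum_root (S : realDomainType) (w : dedge D -> S) r s :
  (forall e, 0 < w e) -> (forall e, w (next e) = w e) ->
  arborescence_sum w r = arborescence_sum w s.
Proof.
move=> w0 wn; pose pi := arborescence_sum w.
pose m := [arg max_(x > r) pi x]%O.
have maxm x : pi x <= pi m by rewrite /m; case: arg_maxP => // y _; apply.
pose P x := pi x == pi m.
have Pcl e : P (source e) -> P (target e).
  move=> /eqP Pe; have := arborescence_sum_harmonic w (source e).
  rewrite -/pi -mulr_suml -(sum_source_next _ wn) mulr_suml Pe => /eqP.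
  (* At a maximum, the weighted gaps [pi m - pi (target g)] are nonnegative with sum zero, so each
     vanishes. *)
  rewrite -subr_eq0 -sumrB psumr_eq0 => [|g _]; last first.
    by rewrite -mulrBr mulr_ge0 ?subr_ge0 // ltW.
  move/allP/(_ e (mem_index_enum _)); rewrite eqxx /= -mulrBr mulf_eq0 gt_eqF //=.
  by rewrite subr_eq0 eq_sym.
have Pclr := target_closed_source Pcl.
(* A spanning tree makes the graph connected regardless of directions; without one, both sums are
   empty. *)
case: (pickP (@spanning_tree D)) => [A /andP[/forallP con _]|no]; last first.
  by rewrite /arborescence_sum !big_pred0 // => A; rewrite /arborescence no.
suff all x : pi x = pi m by rewrite -/(pi r) -/(pi s) !all.
apply/eqP; move: x (forallP (con m) x); apply: connect_ind_r => [|x y _ Px]; first exact: eqxx.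
by case/existsP=> e /andP[_ /orP[]/andP[/eqP ex /eqP ey]]; subst x y;
  [apply: Pcl | apply: Pclr].
Qed.

Lemma poly_arborescence_sum_root (S : realDomainType) (w : dedge D -> {poly S}) r s :
  (forall e (n : nat), 0 < (w e).[n.+1%:R]) -> (forall e, w (next e) = w e) ->
  arborescence_sum w r = arborescence_sum w s.
Proof.
move=> w0 wn; apply/eqP; rewrite -subr_eq0; apply/eqP.
(* A nonzero [q] has degree [size q - 1], so [size q] distinct roots force it to vanish. *)
set q := _ - _; pose rs := [seq n.+1%:R : S | n <- iota 0 (size q)].
apply: (@roots_geq_poly_eq0 _ _ rs); last by rewrite size_map size_iota.
  apply/allP => _ /mapP[n _ ->]; rewrite /root /q !hornerE subr_eq0; apply/eqP.
  have ev x : (arborescence_sum w x).[n.+1%:R] =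
      arborescence_sum (fun e => (w e).[n.+1%:R]) x.
    by rewrite horner_sum; apply: eq_bigr => A _; rewrite horner_prod.
  by rewrite !ev; apply: arborescence_sum_root => e; rewrite ?wn.
by rewrite map_inj_uniq ?iota_uniq // => a b /eqP; rewrite eqr_nat => /eqP[].
Qed.
End RootIndependence.

(** Sending an edge to its target is a bijection from [A] onto the vertices other than [r]. *)
Lemma card_arborescence r A : arborescence r A -> #|A| = #|dvertex D|.-1.
Proof.
rewrite arborescenceP => br; rewrite -(cardC1 r).
have -> : #|predC1 r| = #|[set target e | e in A]|.
  apply: eq_card => u; rewrite !inE; apply/idP/imsetP => [ur|[e eA ->]].
    have [_ /forallP/(_ u)/connect_last[ru|[v _ /arcP[e [eA _ <-]]]]] := andP br.
      by rewrite ru eqxx in ur.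
    by exists e.
  exact: branching_root br eA.
by rewrite card_in_imset // => e g; apply: branching_in br.
Qed.
End Arborescences.

Lemma arborescence_sum_morph (D : digraph) (S T : comNzRingType)
    (f : {rmorphism S -> T}) (w : dedge D -> S) (r : dvertex D) :
  f (arborescence_sum w r) = arborescence_sum (f \o w) r.
Proof. by rewrite rmorph_sum; apply: eq_bigr => A _; rewrite rmorph_prod. Qed.

(** * Weights and clockwise regions in a positive alternating diagram *)

Section Crowell.
Variables (H : embedded_graph) (L : alternating_diagram H).
Implicit Types (x : dart H) (e : edge H).

Lemma tail_rot x : tail (Defs.rot H x) = tail x.
Proof.
by apply/esym/eqP; rewrite -rotP; have := mem_porbit (Defs.rot H) 1 x; rewrite expg1.
Qed.

Lemma over_over_end e : Defs.over L (over_end L e).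
Proof.
rewrite /over_end; case: ifP => // /negbT.
by rewrite -[(e, true)]/(flip (e, false)) over_flip.
Qed.

Lemma over_end_fst e : (over_end L e).1 = e.
Proof. by rewrite /over_end; case: ifP. Qed.

Lemma over_endK x : Defs.over L x -> over_end L x.1 = x.
Proof.
case: x => e [] ox; rewrite /over_end; last by rewrite ox.
by rewrite -[(e, false)]/(flip (e, true)) over_flip ox.
Qed.

(** Both [flip] and [rot] exchange over and under, so a region to the right of one over-dart has
    only over-darts and is clockwise oriented. *)
Lemma over_right_next x : Defs.over L (right_next x) = Defs.over L x.
Proof. by rewrite /right_next over_rot over_flip negbK. Qed.

Definition next_edge e : edge H := (right_next (over_end L e)).1.

Lemma over_end_next e : over_end L (next_edge e) = right_next (over_end L e).
Proof. by rewrite /next_edge over_endK // over_right_next over_over_end. Qed.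

Lemma next_edge_inj : injective next_edge.
Proof.
move=> e g /(congr1 (over_end L)); rewrite !over_end_next => /right_next_inj.
by move/(congr1 fst); rewrite !over_end_fst.
Qed.

Lemma source_next_edge (e : dedge (crowell_digraph L)) :
  @source (crowell_digraph L) (next_edge e) = target e.
Proof. by rewrite /= over_end_next /right_next tail_rot. Qed.

Hypothesis Lpos : positive L.

(** The converse of positivity is positivity at the opposite dart of the over-strand. *)
Lemma out_rot_over x : Defs.over L x -> out L (Defs.rot H x) = out L x.
Proof.
move=> ox; apply/idP/idP; last exact: Lpos.
apply: contraTT => nx; rewrite -out_straight; apply: Lpos.
  by rewrite !over_rot negbK.
by rewrite out_straight.
Qed.

(** Positivity carries the left-right test at the under end to the orientation of that end, hence of
    the over end: the weight is [- 'X] when the link runs along Crowell's direction. *)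
Lemma crowell_weightE e :
  crowell_weight (L := L) e = if out L (over_end L e) then - 'X else 1.
Proof.
have o : Defs.over L ((Defs.rot H)^-1%g (under_end L e)).
  by rewrite -[Defs.over L _]negbK -over_rot permKV over_flip over_over_end.
by rewrite /crowell_weight -(out_rot_over o) permKV out_flip if_neg.
Qed.

Lemma out_right_next x : Defs.over L x -> out L (right_next x) = out L x.
Proof.
move=> ox; have o : Defs.over L (right_next x) by rewrite over_right_next.
by rewrite -(out_rot_over o) out_straight out_flip negbK.
Qed.

Lemma crowell_weight_next e :
  crowell_weight (L := L) (next_edge e) = crowell_weight (L := L) e.
Proof.
by rewrite !crowell_weightE over_end_next out_right_next ?over_over_end.
Qed.

Lemma porbit_labeled e :
  porbit (perm (@right_next_inj H)) (over_end L e)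
    \in labeled_regions L (crowell_weight (L := L) e).
Proof.
set C := porbit _ _.
have CP x : x \in C -> Defs.over L x /\
    crowell_weight (L := L) x.1 = crowell_weight (L := L) e.
  case/porbitP => n ->; elim: n => [|n [on wn]].
    by rewrite expg0 perm1 over_over_end over_end_fst.
  rewrite expgSr permM permE over_right_next; split=> //.
  by rewrite -wn -[RHS]crowell_weight_next /next_edge over_endK.
rewrite !inE -andbA; apply/and3P; split; first exact: imset_f.
  apply/forall_inP => g; rewrite inE => /existsP[b gC].
  by rewrite (over_endK (proj1 (CP _ gC))).
apply/forall_inP => g; rewrite inE => /existsP[b gC].
by case: (CP _ gC) => _ ->.
Qed.

(** By [porbit_labeled] some [R i] contains [e], so the default 0 is not taken; whichever index is
    picked, the label of its region is the weight of [e]. *)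
Lemma region_varE (k l : nat) (R : 'I_k -> {set dart H}) e :
  [set R i | i : 'I_k & (i < l)%N] = labeled_regions L (- 'X) ->
  [set R i | i : 'I_k & (l <= i)%N] = labeled_regions L 1 ->
  exists i : 'I_k,
    region_var R (e : dedge (crowell_digraph L)) = 'X_i /\ (i < l)%N = out L (over_end L e).
Proof.
move=> Rt R1.
have N1X : (1 : {poly int}) != - 'X.
  by apply/eqP => /(congr1 (fun p : {poly int} => p.[0])); rewrite hornerN hornerX hornerC.
have lab (i : 'I_k) : R i \in labeled_regions L (if (i < l)%N then - 'X else 1).
  by case: ltnP => il; rewrite -?Rt -?R1 imset_f ?inE.
have eC : e \in boundary (porbit (perm (@right_next_inj H)) (over_end L e)).
  rewrite inE; apply/existsP; exists (over_end L e).2.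
  by rewrite -{1}(over_end_fst e) -surjective_pairing porbit_id.
have [i Ri] : exists i, R i = porbit (perm (@right_next_inj H)) (over_end L e).
  have := porbit_labeled e; rewrite crowell_weightE; case: ifP => _.
    by rewrite -Rt => /imsetP[i _ ->]; exists i.
  by rewrite -R1 => /imsetP[i _ ->]; exists i.
rewrite /region_var; case: pickP => [j ej|/(_ i)]; last by rewrite Ri eC.
exists j; split=> //; have /setIdP[_ /forall_inP/(_ e ej)] := lab j.
by rewrite crowell_weightE; do 2!case: ifP => // _; rewrite 1?[_ == 1]eq_sym (negPf N1X).
Qed.
End Crowell.

(** The common form of all the specialisations: [t], [q] become ['X], [1] for the first identity and
    [var_t], [var_q] for the second. *)
Definition monomial_weight (H : embedded_graph) (L : alternating_diagram H)
    (S : comNzRingType) (t q : S) (e : dedge (crowell_digraph L)) : S :=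
  if out L (over_end L e) then t else q.

Lemma prod_monomial_weight (H : embedded_graph) (L : alternating_diagram H)
    (S : comNzRingType) (t q : S) (A : {set dedge (crowell_digraph L)}) :
  \prod_(e in A) monomial_weight t q e =
  t ^+ #|[set e in A | out L (over_end L e)]| *
  q ^+ (#|A| - #|[set e in A | out L (over_end L e)]|).
Proof.
set B := [set e in A | _]; have sBA : B \subset A by apply/subsetP => e /[!inE] /andP[].
rewrite (big_setID B) /= (setIidPr sBA) -cardsDS //; congr (_ * _);
  rewrite -prodr_const; apply: eq_bigr => e; rewrite !inE /monomial_weight.
  by case/andP=> _ ->.
by case/andP=> /nandP[/negPf->//|/negPf->].
Qed.

(** * Homogenization as an additive map *)

Section Homogenization.
Variable d : nat.

(** A bound independent of [P] lets two polynomials be compared coefficientwise, for additivity. *)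
Lemma homogenizeE n (P : {poly int}) : (size P <= n)%N ->
  homogenize d P = \sum_(i < n) P`_i *: (var_t ^+ i * var_q ^+ (d - i)).
Proof.
move=> le_n; rewrite /homogenize.
rewrite (big_ord_widen _ (fun i => P`_i *: (var_t ^+ i * var_q ^+ (d - i))) le_n).
rewrite big_mkcond; apply: eq_bigr => i _; case: ltnP => // /(nth_default 0) ->.
by rewrite scale0r.
Qed.

Lemma homogenize_additive : additive (homogenize d).
Proof.
move=> P Q; pose n := maxn (size P) (size Q).
rewrite !(@homogenizeE n) ?leq_maxl ?leq_maxr //; last first.
  by rewrite (leq_trans (size_polyD _ _)) // size_polyN.
by rewrite -sumrB; apply: eq_bigr => i _; rewrite coefB scalerBl.
Qed.

HB.instance Definition _ :=
  GRing.isAdditive.Build {poly int} {mpoly int[2]} (homogenize d) homogenize_additive.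

Lemma homogenizeXn a : homogenize d 'X^a = var_t ^+ a * var_q ^+ (d - a).
Proof.
rewrite /homogenize size_polyXn big_ord_recr /= coefXn eqxx scale1r big1 ?add0r // => i _.
by rewrite coefXn ltn_eqF ?scale0r.
Qed.
End Homogenization.

Theorem theorem3p5 (G : embedded_graph)
  (hconn : connected G) (hplane : plane G) (hbip : bipartite G)
  (L : alternating_diagram (medial G)) (hpos : positive L)
  (k l : nat) (hlk : (l <= k)%N)
  (R : 'I_k -> {set dart (medial G)}) (hinj : injective R)
  (hRt : [set R i | i : 'I_k & (i < l)%N] = labeled_regions L (- 'X))
  (hR1 : [set R i | i : 'I_k & (l <= i)%N] = labeled_regions L 1)
  (r s : dvertex (crowell_digraph L)) :
  alexander r \Po (- 'X)
    = mmap (@polyC int) (fun i : 'I_k => if (i < l)%N then 'X else 1)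
        (M_polynomial R s)
  /\
  homogenize #|dvertex (crowell_digraph L)|.-1 (alexander r \Po (- 'X))
    = mmap (@mpolyC 2 int) (fun i : 'I_k => if (i < l)%N then var_t else var_q)
        (M_polynomial R s).
Proof.
have eqw (S : comNzRingType) (w w' : dedge (crowell_digraph L) -> S) x :
    w =1 w' -> arborescence_sum w x = arborescence_sum w' x.
  by move=> e; apply: eq_bigr => A _; apply: eq_bigr => a _; apply: e.
have mmapM (S : comNzRingType) (f : {rmorphism int -> S}) (t q : S) :
    mmap f (fun i : 'I_k => if (i < l)%N then t else q) (M_polynomial R s) =
    arborescence_sum (@monomial_weight _ L S t q) s.
  rewrite /M_polynomial arborescence_sum_morph; apply: eqw => e /=.
  have [i [-> il]] := region_varE hpos e hRt hR1.
  by rewrite mmapX mmap1U /monomial_weight il.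
have alexE : alexander r \Po (- 'X) = arborescence_sum (@monomial_weight _ L _ 'X 1) s.
  transitivity (arborescence_sum (@monomial_weight _ L _ ('X : {poly int}) 1) r).
    rewrite /alexander [LHS](arborescence_sum_morph (comp_poly (- 'X))).
    apply: eqw => e /=; rewrite crowell_weightE // /monomial_weight.
    by case: ifP => _; rewrite ?rmorphN ?rmorph1 /= ?comp_polyX ?opprK.
  (* The root moves from [r] to [s]; at positive integers both weights ['X] and [1] are positive,
     and they are constant along regions. *)
  apply: (poly_arborescence_sum_root (D := crowell_digraph L)
    (@next_edge_inj _ L) (@source_next_edge _ L)).
    by move=> e n; rewrite /monomial_weight; case: ifP; rewrite hornerE ?ltr01 ?ltr0Sn.
  by move=> e; rewrite /monomial_weight over_end_next out_right_next ?over_over_end.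
rewrite alexE !mmapM; split=> //.
(* Each arborescence contributes one monomial; as it has exactly [d] edges, the exponent of [var_q]
   counts its edges labeled 1. *)
rewrite raddf_sum; apply: eq_bigr => A arA.
rewrite !prod_monomial_weight expr1n mulr1 (card_arborescence arA).
exact: homogenizeXn.
Qed.
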